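(* Let $F$ be a field, $R=F[x_1,\dots,x_n]$, and let $I\subset R$ be a squarefree monomial ideal of degree $d$ (that is, all minimal monomial generators of $I$ have degree $d$) with $\mathrm{supp}(I)=\{x_1,\dots,x_n\}$, whose minimal generating set $G(I)$ is a perfect set. Let $(a_{-1},a_0,a_1,\dots,a_{d-1})\in\mathbb{Z}^{d+1}$ and put $a_i=0$ for all $i\ge d$. Then $I$ is a quasi $f$-ideal of type $(a_{-1},a_0,a_1,\dots,a_{d-1})$ if and only if the Newton complementary dual $\widehat I$ is a quasi $f$-ideal of type $(a_{n-1},a_{n-2},a_{n-3},\dots,a_{-1})$.
   Context: $G(I)$ is the unique minimal set of monomial generators of a monomial ideal $I$; $\mathrm{supp}(I)$ is the set of variables dividing at least one element of $G(I)$. The Newton complementary dual of a squarefree monomial ideal $I$ is $\widehat I=\left\langle \frac{x_1x_2\cdots x_n}{u} : u\in G(I)\right\rangle$. Perfect sets: let $sm(R)_e$ be the set of squarefree monomials of degree $e$ in $R$. For $A\subseteq sm(R)_d$ put $\sqcup(A)=\{g x_i : g\in A,\ 1\le i\le n,\ x_i\nmid g\}$ and $\sqcap(A)=\{g/x_i : g\in A,\ 1\le i\le n,\ x_i\mid g\}$. $A$ is lower perfect if $\sqcap(A)=sm(R)_{d-1}$, upper perfect if $\sqcup(A)=sm(R)_{d+1}$, and perfect if it is both lower and upper perfect. Complexes: let $V=\{v_1,\dots,v_n\}$. For a squarefree monomial ideal $J\subseteq R$, the facet complex $\delta_{\mathcal F}(J)$ consists of all subsets of $V$ contained in $\{v_k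 : x_k\mid u\}$ for some $u\in G(J)$; the non-face (Stanley-Reisner) complex $\delta_{\mathcal N}(J)$ consists of all subsets $\{v_{i_1},\dots,v_{i_k}\}\subseteq V$ (distinct vertices) such that $x_{i_1}\cdots x_{i_k}\notin J$. The dimension of a set $W\subseteq V$ is $|W|-1$ (so $\dim\emptyset=-1$), the dimension of a complex is the maximum of the dimensions of its faces, and $f_i(\Delta)$ is the number of faces of $\Delta$ of dimension $i$ (equal to $0$ for $i>\dim\Delta$). Quasi $f$-ideals: $J$ is a quasi $f$-ideal of type $(a_{-1},a_0,\dots,a_s)$ if $\dim\delta_{\mathcal F}(J)=\dim\delta_{\mathcal N}(J)$ and $f_i(\delta_{\mathcal N}(J))-f_i(\delta_{\mathcal F}(J))=a_i$ for all $i\ge -1$, where $a_i$ is taken to be $0$ for $i>s$. Thus trailing zeros may be appended to or removed from a type beyond the index equal to the common dimension. In particular, $\widehat I$ being of type $(a_{n-1},a_{n-2},\dots,a_{-1})$ means that the two complexes of $\widehat I$ have equal dimension and $f_j(\delta_{\mathcal N}(\widehat I))-f_j(\delta_{\mathcal F}(\widehat I))=a_{n-j-2}$ for all $-1\le j\le n-1$. *)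

(* Defs.v *)
From HB Require Import structures.
From mathcomp Require Import all_boot all_order all_algebra.
From mathcomp Require Import boolp classical_sets.
From mathcomp Require Import mpoly.

Set Implicit Arguments.
Unset Strict Implicit.
Unset Printing Implicit Defensive.

Import GRing.Theory.

Local Open Scope classical_set_scope.
Local Open Scope ring_scope.

(* Throughout, a monomial x_1^(m 1) ... x_n^(m n) is represented by its exponent
   vector m : 'X_{1..n} (the polynomial itself is 'X_[m]); (m1 <= m2)%MM is
   divisibility, and (m1 - m2)%MM is the quotient m1 / m2 whenever m2 divides
   m1.  The variable x_i and the vertex v_i are both indexed by i : 'I_n. *)

Section Ideals.

Variables (F : fieldType) (n : nat).
Implicit Types (I J : set {mpoly F[n]}) (A B : set 'X_{1..n}).

(* Ideals are not required to be proper: the Newton complementary dual of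
   <x_1 ... x_n> is the whole ring. *)
Definition is_ideal J : Prop :=
  [/\ J 0, forall p q, J p -> J q -> J (p + q)
         & forall p q, J q -> J (p * q)].

Definition monomial_span A : set {mpoly F[n]} :=
  smallest is_ideal [set 'X_[m] | m in A].

Definition squarefree (m : 'X_{1..n}) : Prop := forall i, (m i <= 1)%N.

Definition squarefree_monomial_ideal I : Prop :=
  exists2 A : set 'X_{1..n}, A `<=` squarefree & I = monomial_span A.

Definition minimal_generating_set I : set (set 'X_{1..n}) :=
  [set A | monomial_span A = I /\
           forall B, B `<=` A -> monomial_span B = I -> B = A].

(* G(I).  A monomial ideal has exactly one minimal set of monomial generators,
   so this union ranges over a single set: see [mingensP] and [mingens_uniq]. *)
Definition mingens I : set 'X_{1..n} :=
  \bigcup_(A in minimal_generating_set I) A.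

Definition supp I : set 'I_n :=
  [set i | exists2 u, mingens I u & (U_(i) <= u)%MM].

Definition generated_in_degree (d : nat) I : Prop :=
  forall u, mingens I u -> mdeg u = d.

Definition full_monomial : 'X_{1..n} := [multinom 1%N | i < n].

Definition newton_dual I : set {mpoly F[n]} :=
  monomial_span [set (full_monomial - u)%MM | u in mingens I].

End Ideals.

Section PerfectSets.

Variable n : nat.
Implicit Types (A : set 'X_{1..n}).

(* The degree is an integer so that sm (0 - 1) is empty. *)
Definition sm (e : int) : set 'X_{1..n} :=
  [set m | squarefree m /\ (mdeg m)%:Z = e].

Definition sqcup A : set 'X_{1..n} :=
  [set m | exists g i, [/\ A g, ~~ (U_(i) <= g)%MM & m = (g + U_(i))%MM]].

Definition sqcap A : set 'X_{1..n} :=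
  [set m | exists g i, [/\ A g, (U_(i) <= g)%MM & m = (g - U_(i))%MM]].

Definition lower_perfect (d : nat) A : Prop := sqcap A = sm (d%:Z - 1).

Definition upper_perfect (d : nat) A : Prop := sqcup A = sm (d%:Z + 1).

Definition perfect (d : nat) A : Prop :=
  lower_perfect d A /\ upper_perfect d A.

End PerfectSets.

Section Complexes.

Variables (F : fieldType) (n : nat).
Implicit Types (J : set {mpoly F[n]}) (W : {set 'I_n})
  (Delta : {set {set 'I_n}}).

Definition facet_complex J : {set {set 'I_n}} :=
  [set W : {set 'I_n} | `[< exists2 u, mingens J u &
     W \subset [set k : 'I_n | (U_(k) <= u)%MM]%SET >]]%SET.

Definition nonface_complex J : {set {set 'I_n}} :=
  [set W : {set 'I_n} | `[< ~ J (\prod_(i in W) 'X_i) >]]%SET.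

Definition dim_face W : int := #|W|%:Z - 1.

(* A relation rather than a function, since the complex without any face (which
   is the non-face complex of the unit ideal) has no dimension. *)
Definition is_dim Delta (e : int) : Prop :=
  (exists2 W, W \in Delta & dim_face W = e) /\
  (forall W, W \in Delta -> dim_face W <= e).

Definition fnum (i : int) Delta : nat :=
  #|[set W in Delta | dim_face W == i]%SET|.

(* A type (t_{-1}, t_0, ..., t_s) is stored as the sequence of its entries;
   [type_entry t i], only meant for i >= -1, is t_i, or 0 if i > s. *)
Definition type_entry (t : seq int) (i : int) : int := nth 0 t (absz (i + 1)).

Definition quasi_f_ideal J (t : seq int) : Prop :=
  (exists e, is_dim (facet_complex J) e /\ is_dim (nonface_complex J) e) /\
  (forall i : int, -1 <= i ->
     (fnum i (nonface_complex J))%:Z - (fnum i (facet_complex J))%:Z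
       = type_entry t i).

End Complexes.

(* (a_{n-1}, a_{n-2}, ..., a_{-1}), with a_i = 0 beyond the end of a. *)
Definition reversed_type (n : nat) (a : seq int) : seq int :=
  mkseq (fun k => type_entry a (n%:Z - 1 - k%:Z)) n.+1.

Section MinimalGenerators.

Variables (F : fieldType) (n : nat).
Implicit Types (I : set {mpoly F[n]}) (A B : set 'X_{1..n}).

Local Notation span A := (@monomial_span F n A).

Lemma monomial_span_ideal A : is_ideal (span A).
Proof.
split=> [J [[]] //|p q Ip Iq J JA|p q Iq J JA]; case: (JA) => [[_ JD JM] _].
  by apply: JD; [exact: Ip | exact: Iq].
by apply: JM; exact: Iq.
Qed.

Lemma monomial_span_sub A I :
  is_ideal I -> (forall a, A a -> I 'X_[a]) -> span A `<=` I.
Proof. by move=> idI AI; apply: smallest_sub => // _ [a Aa <-]; exact: AI. Qed.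

Lemma monomial_spanP A m :
  span A 'X_[m] <-> exists2 a, A a & (a <= m)%MM.
Proof.
split=> [|[a Aa le_am]]; last first.
  have [_ _ spM] := monomial_span_ideal A.
  rewrite -(submK le_am) mpolyXD; apply: spM.
  by apply: sub_gen_smallest; exists a.
pose P (k : 'X_{1..n}) := exists2 a, A a & (a <= k)%MM.
pose J : set {mpoly F[n]} := [set p | forall k, k \in msupp p -> P k].
have idJ : is_ideal J.
  split=> [k|p q Jp Jq k|p q Jq k]; first by rewrite msupp0.
    by move/msuppD_le; rewrite mem_cat => /orP[/Jp|/Jq].
  move/msuppM_le => /allpairsP[[k1 k2] [/= _ /Jq[a Aa le_a] ->]].
  by exists a => //; apply: lepm_trans le_a _; exact: lem_addl.
have spJ : span A `<=` J.
  apply: monomial_span_sub => // a Aa k.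
  by rewrite msuppX inE => /eqP ->; exists a => //; exact: lepm_refl.
by move=> /spJ; apply; rewrite msuppX mem_head.
Qed.

Lemma lepm_anti (m1 m2 : 'X_{1..n}) :
  (m1 <= m2)%MM -> (m2 <= m1)%MM -> m1 = m2.
Proof.
move=> /mnm_lepP le12 /mnm_lepP le21.
by apply/mnmP => i; apply/eqP; rewrite eqn_leq le12 le21.
Qed.

Lemma minimal_generating_set_anti I A a b : minimal_generating_set I A ->
  A a -> A b -> (a <= b)%MM -> a = b.
Proof.
move=> [spA minA] Aa Ab le_ab; apply: contrapT => ne_ab.
have: A `\ b = A.
  apply: minA => [c [] //|]; rewrite -spA; apply/seteqP; split.
    apply: monomial_span_sub => [|c [Ac _]]; first exact: monomial_span_ideal.
    by apply/monomial_spanP; exists c => //; exact: lepm_refl.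
  apply: monomial_span_sub => [|c Ac]; first exact: monomial_span_ideal.
  apply/monomial_spanP; have [->|/eqP ne_cb] := eqVneq c b.
    by exists a.
  by exists c => //; exact: lepm_refl.
by move=> /seteqP[_ sub]; have [_ nbb] := sub b Ab; exact: nbb.
Qed.

Lemma minimal_generating_set_uniq I A B :
  minimal_generating_set I A -> minimal_generating_set I B -> A = B.
Proof.
move: A B; suff sub A B : minimal_generating_set I A ->
    minimal_generating_set I B -> A `<=` B.
  by move=> A B mA mB; apply/seteqP; split; apply: sub.
move=> mA mB a Aa.
have spAB : span A = span B by rewrite mA.1 mB.1.
have [b Bb le_ba] : exists2 b, B b & (b <= a)%MM.
  apply/monomial_spanP; rewrite -spAB.
  by apply/monomial_spanP; exists a => //; exact: lepm_refl.
have [c Ac le_cb] : exists2 c, A c & (c <= b)%MM.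
  apply/monomial_spanP; rewrite spAB.
  by apply/monomial_spanP; exists b => //; exact: lepm_refl.
have eca := minimal_generating_set_anti mA Ac Aa (lepm_trans le_cb le_ba).
by rewrite -(lepm_anti le_ba) // -eca.
Qed.

Lemma mingens_uniq I A : minimal_generating_set I A -> mingens I = A.
Proof.
move=> mA; apply/seteqP; split=> [m [B mB Bm]|m Am]; last by exists A.
by rewrite (minimal_generating_set_uniq mA mB).
Qed.

Lemma mingensP A : minimal_generating_set (span A) (mingens (span A)).
Proof.
suff [M mM] : exists M, minimal_generating_set (span A) M.
  by rewrite (mingens_uniq mM).
pose M := [set m | A m /\ forall k, A k -> (k <= m)%MM -> k = m].
have below d a : A a -> (mdeg a <= d)%N -> exists2 m, M m & (m <= a)%MM.
  elim: d a => [|d IHd] a Aa le_ad;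
      (have [Ma|] := pselect (M a); first by exists a => //; exact: lepm_refl);
      move=> nMa; have [k [Ak le_ka ne_ka]] :
        exists k, [/\ A k, (k <= a)%MM & k <> a].
  - apply: contrapT => nk; apply: nMa; split=> // k Ak le_ka.
    by apply: contrapT => ne_ka; apply: nk; exists k.
  - exfalso; apply: ne_ka; apply: lepm_anti => //.
    move: le_ad; rewrite leqn0 mdeg_eq0 => /eqP ->.
    by apply/mnm_lepP => i; rewrite mnm0E.
  - apply: contrapT => nk; apply: nMa; split=> // k Ak le_ka.
    by apply: contrapT => ne_ka; apply: nk; exists k.
  have lt_ka : (mdeg k < mdeg a)%N.
    rewrite -(submK le_ka) mdegD -[X in (X < _)%N]add0n ltn_add2r lt0n.
    rewrite mdeg_eq0; apply/eqP => eq0; apply: ne_ka.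
    by rewrite -[RHS](submK le_ka) eq0 add0m.
  have [m Mm le_mk] := IHd k Ak (leq_trans lt_ka le_ad).
  by exists m => //; exact: lepm_trans le_mk le_ka.
exists M; split=> [|B BM spB].
  apply/seteqP; split; apply: monomial_span_sub => [|a]; try exact: monomial_span_ideal.
    by case=> Aa _; apply/monomial_spanP; exists a => //; exact: lepm_refl.
  by move=> Aa; apply/monomial_spanP; exact: below Aa (leqnn _).
apply/seteqP; split=> // m [Am minm].
have [b Bb le_bm] : exists2 b, B b & (b <= m)%MM.
  apply/monomial_spanP; rewrite spB.
  by apply/monomial_spanP; exists m => //; exact: lepm_refl.
by rewrite -(minm b) //; case: (BM b Bb).
Qed.

End MinimalGenerators.

(* Main.v *)
Require Import Defs.
From HB Require Import structures.
From mathcomp Require Import all_boot all_order all_algebra.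
From mathcomp Require Import boolp classical_sets.
From mathcomp Require Import mpoly.
From mathcomp Require Import zify.

(** Identify a squarefree monomial with its set of variables, and let H be the
    family of d-subsets given by the generators of I.  The faces of the facet
    complex are the sets lying below a member of H ([down_closure]), those of the
    non-face complex are the sets lying above no member of H ([avoiders]), and the
    dual of I corresponds to the family of complements of the members of H.

    Taking complements reverses inclusion, so a set W lies above a member of H
    exactly when its complement lies below a complement of a member of H.  Hence
    the facet complex of the dual of I is the Alexander dual of the non-face
    complex of I, and vice versa.  Since a complex with f faces of size k has an
    Alexander dual with 'C(n, k) - f faces of size n - k, the two complexes of the
    dual have in size k the same difference of face numbers as the two complexes
    of I in size n - k ([fnum_diff_newton_dual]): the types are reversals of each
    other.

    It remains to compare dimensions.  When G(I) is upper perfect, every set with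
    more than d elements lies above a member of H, and then the two dimensions
    agree exactly when H is nonempty and misses some d-set ([same_dimensionP]).
    This criterion is invariant under complementation, which exchanges upper and
    lower perfectness, so it holds for I if and only if it holds for the dual
    ([same_dimension_complements]). *)

Local Open Scope classical_set_scope.
Local Open Scope ring_scope.

(** * Families of subsets and Alexander duality *)

Section SetFamilies.

Set Implicit Arguments.
Unset Strict Implicit.

Variable n : nat.
Implicit Types (U W : {set 'I_n}) (H D : {set {set 'I_n}}).

Definition down_closure H : {set {set 'I_n}} :=
  [set W : {set 'I_n} | [exists U in H, W \subset U]]%SET.

Definition avoiders H : {set {set 'I_n}} :=
  [set W : {set 'I_n} | ~~ [exists U in H, U \subset W]]%SET.

Definition complements H : {set {set 'I_n}} := [set ~: U | U in H]%SET.

Definition alexander_dual D : {set {set 'I_n}} :=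
  [set W : {set 'I_n} | (~: W)%SET \notin D]%SET.

Lemma mem_complements H W : (W \in complements H) = ((~: W)%SET \in H).
Proof.
apply/imsetP/idP => [[U HU ->]|HW]; first by rewrite finset.setCK.
by exists (~: W)%SET; rewrite ?finset.setCK.
Qed.

Lemma avoiders_complements H :
  avoiders (complements H) = alexander_dual (down_closure H).
Proof.
apply/setP => W; rewrite !inE; congr (~~ _).
apply/exists_inP/exists_inP => -[U HU sub]; exists (~: U)%SET.
- by rewrite -mem_complements.
- by rewrite finset.setCS.
- by rewrite mem_complements finset.setCK.
- by rewrite -finset.setCS finset.setCK.
Qed.

Lemma down_closure_complements H :
  down_closure (complements H) = alexander_dual (avoiders H).
Proof.
apply/setP => W; rewrite !inE negbK.
apply/exists_inP/exists_inP => -[U HU sub]; exists (~: U)%SET.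
- by rewrite -mem_complements.
- by rewrite finset.setCS.
- by rewrite mem_complements finset.setCK.
- by rewrite -finset.setCS finset.setCK.
Qed.

Lemma fnumE (k : nat) D :
  fnum (k%:Z - 1) D = #|[set W in D | #|W| == k]%SET|.
Proof.
by congr #|pred_of_set _|; apply/setP => W; rewrite !inE /dim_face; congr (_ && _); lia.
Qed.

(** Complementation matches the k-sets outside the Alexander dual with the faces
    of size n - k of the complex, so together these count all k-sets. *)
Lemma fnum_alexander_dual (k : nat) D : (k <= n)%N ->
  (fnum (k%:Z - 1) (alexander_dual D) + fnum ((n - k)%N%:Z - 1) D)%N = 'C(n, k).
Proof.
move=> le_kn; rewrite !fnumE.
have -> : #|[set W in D | #|W| == (n - k)%N]%SET| =
    #|[set W : {set 'I_n} | (~: W \in D) && (#|W| == k)]%SET|.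
  rewrite -(card_imset _ (@finset.setC_inj _)).
  congr #|pred_of_set _|; apply/setP => W; rewrite -/(complements _).
  rewrite mem_complements !inE finset.setCK; congr (_ && _).
  by have := cardsC W; rewrite card_ord; lia.
rewrite -[X in 'C(X, _)]card_ord -card_draws addnC.
rewrite -[RHS](cardsID [set W : {set 'I_n} | ~: W \in D]%SET).
by congr (_ + _)%N; apply: eq_card => W; rewrite !inE // andbC.
Qed.

Lemma fnum_gt (k : nat) D : (n < k)%N -> fnum (k%:Z - 1) D = 0%N.
Proof.
move=> lt_nk; rewrite fnumE; apply/eqP; rewrite cards_eq0; apply/eqP/setP => W.
rewrite !inE; apply/andP => -[_ /eqP Wk].
by have := max_card W; rewrite card_ord; lia.
Qed.

Definition same_dimension D1 D2 := exists e, is_dim D1 e /\ is_dim D2 e.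

(** The downward closure has dimension d - 1 as soon as H is nonempty, and a set
    avoiding H has at most d elements; an avoiding set of size d is just a d-set
    outside H, because an inclusion between d-sets is an equality. *)
Lemma same_dimensionP (d : nat) H :
    (forall U, U \in H -> #|U| = d) ->
    (forall W, W \in avoiders H -> (#|W| <= d)%N) ->
  same_dimension (down_closure H) (avoiders H) <->
  (exists U, U \in H) /\ (exists2 W, W \notin H & #|W| = d).
Proof.
move=> Hd avd.
have downH U : U \in H -> U \in down_closure H.
  by move=> HU; rewrite inE; apply/exists_inP; exists U.
have dim_down U : U \in H -> is_dim (down_closure H) (d%:Z - 1).
  move=> HU; split; first by exists U; [exact: downH | rewrite /dim_face Hd].
  move=> W; rewrite inE => /exists_inP[U' HU' /subset_leq_card].
  by rewrite (Hd _ HU') /dim_face; lia.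
split=> [[e [[[W + <-] maxF] [[W' + dW'] maxN]]]|[[U HU] [W nHW Wd]]].
  rewrite inE => /exists_inP[U HU subWU] avW'; split; first by exists U.
  exists W'.
    by apply: contraL avW' => HW'; rewrite inE negbK; apply/exists_inP; exists W'.
  have := maxF _ (downH _ HU); have := avd _ avW'; have := subset_leq_card subWU.
  by move: dW'; rewrite /dim_face (Hd _ HU); lia.
exists (d%:Z - 1); split; first exact: dim_down _ HU.
split=> [|W' /avd]; last by rewrite /dim_face; lia.
exists W; last by rewrite /dim_face Wd.
rewrite inE; apply/exists_inP => -[U' HU' sub]; case/negP: nHW.
suff <- : U' = W by [].
by apply/eqP; rewrite eqEcard sub Wd (Hd _ HU') leqnn.
Qed.

(** The criterion of [same_dimensionP] is symmetric under complementation.  The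
    last hypothesis, read on complements, is the bound on the size of the avoiders
    that this criterion requires of the complementary family. *)
Lemma same_dimension_complements d H :
    (forall U, U \in H -> #|U| = d) ->
    (forall W, W \in avoiders H -> (#|W| <= d)%N) ->
    (forall W, (#|W| < d <= n)%N -> W \in down_closure H) ->
  same_dimension (down_closure H) (avoiders H) <->
  same_dimension (down_closure (complements H)) (avoiders (complements H)).
Proof.
move=> Hd avd downd.
have [[U0 HU0]|nH] := pselect (exists U, U \in H); last first.
  have nC : ~ exists U, U \in complements H.
    by case=> U; rewrite mem_complements => HU; apply: nH; exists (~: U)%SET.
  by split=> -[e [[[W + _] _] _]]; rewrite inE => /exists_inP[U HU _];
     exfalso; [apply: nH | apply: nC]; exists U.
have cardC (V : {set 'I_n}) : (#|V| + #|(~: V)%SET| = n)%N by rewrite cardsC card_ord.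
have le_dn : (d <= n)%N by have := cardC U0; rewrite (Hd _ HU0); lia.
have CHd U : U \in complements H -> #|U| = (n - d)%N.
  by rewrite mem_complements => /Hd; have := cardC U; lia.
have avC W : W \in avoiders (complements H) -> (#|W| <= n - d)%N.
  rewrite avoiders_complements inE leqNgt; apply: contra => ltW.
  by apply: downd; rewrite le_dn andbT; have := cardC W; lia.
rewrite (same_dimensionP Hd avd) (same_dimensionP CHd avC).
split=> -[[U HU] [W nHW Wd]]; split.
- by exists (~: U)%SET; rewrite mem_complements finset.setCK.
- exists (~: W)%SET; first by rewrite mem_complements finset.setCK.
  by have := cardC W; lia.
- by exists (~: U)%SET; rewrite -mem_complements.
- exists (~: W)%SET; first by rewrite -mem_complements.
  by have := cardC W; lia.
Qed.

Lemma exists_subset_card W (k : nat) : (k <= #|W|)%N ->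
  exists2 U : {set 'I_n}, U \subset W & #|U| = k.
Proof.
move=> le_kW; have /card_gt0P[U] : (0 < #|[set U : {set 'I_n} | U \subset W & #|U| == k]%SET|)%N.
  by rewrite cards_draws bin_gt0.
by rewrite inE => /andP[sub /eqP]; exists U.
Qed.

Lemma exists_superset_card W (k : nat) : (#|W| <= k <= n)%N ->
  exists2 U : {set 'I_n}, W \subset U & #|U| = k.
Proof.
have cardC (V : {set 'I_n}) : (#|V| + #|(~: V)%SET| = n)%N by rewrite cardsC card_ord.
move=> le_Wk; have [|U sub Uk] := @exists_subset_card (~: W)%SET (n - k)%N.
  by have := cardC W; lia.
exists (~: U)%SET; first by rewrite -finset.setCS finset.setCK.
by have := cardC U; lia.
Qed.

End SetFamilies.

(** * Squarefree monomials as sets of variables *)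

Section SquarefreeMonomials.

Set Implicit Arguments.
Unset Strict Implicit.

Variable n : nat.
Implicit Types (U W : {set 'I_n}) (u m : 'X_{1..n}).

Definition mnm_of_set W : 'X_{1..n} := [multinom nat_of_bool (i \in W) | i < n].

Definition set_of_mnm u : {set 'I_n} := [set k | (U_(k) <= u)%MM]%SET.

Lemma mem_set_of_mnm u i : (i \in set_of_mnm u) = (0 < u i)%N.
Proof.
rewrite inE; apply/mnm_lepP/idP => [/(_ i)|ui j]; first by rewrite mnm1E eqxx.
by rewrite mnm1E; case: eqP => [<-|].
Qed.

Lemma mnm_of_setK : cancel mnm_of_set set_of_mnm.
Proof. by move=> W; apply/setP => i; rewrite mem_set_of_mnm mnmE; case: (i \in W). Qed.

Lemma set_of_mnmK u : squarefree u -> mnm_of_set (set_of_mnm u) = u.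
Proof.
move=> sqf; apply/mnmP => i; rewrite mnmE mem_set_of_mnm.
by case: (u i) (sqf i) => [|[]].
Qed.

Lemma squarefree_mnm_of_set W : squarefree (mnm_of_set W).
Proof. by move=> i; rewrite mnmE leq_b1. Qed.

Lemma mnm_of_set_le U W : (mnm_of_set U <= mnm_of_set W)%MM = (U \subset W).
Proof.
apply/mnm_lepP/fintype.subsetP => sub i; have := sub i; rewrite !mnmE;
  by do 2![case: (i \in _)] => // /(_ isT).
Qed.

Lemma mdeg_mnm_of_set W : mdeg (mnm_of_set W) = #|W|.
Proof.
rewrite mdegE -sum1_card [RHS]big_mkcond; apply: eq_bigr => i _.
by rewrite mnmE; case: (i \in W).
Qed.

Lemma full_sub_mnm_of_set W : (full_monomial n - mnm_of_set W)%MM = mnm_of_set (~: W)%SET.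
Proof. by apply/mnmP => i; rewrite mnmBE !mnmE inE; case: (i \in W). Qed.

Lemma prodX_set (F : fieldType) W :
  \prod_(i in W) 'X_i = 'X_[mnm_of_set W] :> {mpoly F[n]}.
Proof.
rewrite -(big_morph (fun m => 'X_[m]) (@mpolyXD n F) (@mpolyX0 n F)).
congr 'X_[_]; apply/mnmP => i; rewrite mnm_sumE mnmE.
have [iW|niW] := boolP (i \in W).
  rewrite (bigD1 i) //= mnm1E eqxx big1 // => j /andP[_ /negPf ne_ji].
  by rewrite mnm1E ne_ji.
rewrite big1 // => j jW; rewrite mnm1E.
by case: eqP jW niW => // -> ->.
Qed.

End SquarefreeMonomials.

(** * The complexes of a squarefree monomial ideal *)

Section SquarefreeIdeals.

Set Implicit Arguments.
Unset Strict Implicit.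

Variables (F : fieldType) (n : nat).
Implicit Types (I J : set {mpoly F[n]}) (U W : {set 'I_n}) (A : set 'X_{1..n}).

Definition generator_sets J : {set {set 'I_n}} :=
  [set U : {set 'I_n} | `[< mingens J (mnm_of_set U) >]]%SET.

Lemma mem_generator_sets J U :
  (U \in generator_sets J) <-> mingens J (mnm_of_set U).
Proof. by rewrite inE; split=> /asboolP. Qed.

(** A minimal generator m is a multiple of some squarefree generator a, which is
    itself a multiple of some minimal generator; by minimality these coincide. *)
Lemma mingens_squarefree I :
  squarefree_monomial_ideal I -> mingens I `<=` @squarefree n.
Proof.
case=> A sqfA -> m Mm; have mM := mingensP F A.
have [a Aa le_am] : exists2 a, A a & (a <= m)%MM.
  apply/(monomial_spanP F); rewrite -mM.1.
  by apply/monomial_spanP; exists m => //; exact: lepm_refl.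
have [b Mb le_ba] : exists2 b, mingens (@monomial_span F n A) b & (b <= a)%MM.
  apply/(monomial_spanP F); rewrite mM.1.
  by apply/monomial_spanP; exists a => //; exact: lepm_refl.
have eq_bm := minimal_generating_set_anti mM Mb Mm (lepm_trans le_ba le_am).
by rewrite -(lepm_anti le_am) -?eq_bm //; exact: sqfA.
Qed.

Lemma monomial_span_mingens I :
  squarefree_monomial_ideal I -> @monomial_span F n (mingens I) = I.
Proof. by case=> A _ ->; case: (mingensP F A). Qed.

(** Divisibility between monomials of equal degree is equality, so no generator
    is redundant. *)
Lemma mingens_equidegree A d :
  (forall u, A u -> mdeg u = d) -> mingens (@monomial_span F n A) = A.
Proof.
move=> degA; apply: mingens_uniq; split=> // B BA spB.
apply/seteqP; split=> // u Au.
have [b Bb le_bu] : exists2 b, B b & (b <= u)%MM.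
  apply/(monomial_spanP F); rewrite spB.
  by apply/monomial_spanP; exists u => //; exact: lepm_refl.
suff <- : b = u by [].
have := congr1 mdeg (submK le_bu); rewrite mdegD (degA u Au) (degA b (BA b Bb)).
move/(congr1 (subn^~ d)); rewrite addnK subnn => /eqP; rewrite mdeg_eq0 => /eqP eq0.
by rewrite -[RHS](submK le_bu) eq0 add0m.
Qed.

Lemma facet_complexE J : squarefree_monomial_ideal J ->
  facet_complex J = down_closure (generator_sets J).
Proof.
move=> /mingens_squarefree sqf; apply/setP => W; rewrite !inE.
apply/asboolP/exists_inP => [[u Ju sub]|[U /mem_generator_sets JU sub]].
  exists (set_of_mnm u) => //.
  by apply/mem_generator_sets; rewrite set_of_mnmK //; exact: sqf.
by exists (mnm_of_set U) => //; rewrite -/(set_of_mnm _) mnm_of_setK.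
Qed.

Lemma nonface_complexE J : squarefree_monomial_ideal J ->
  nonface_complex J = avoiders (generator_sets J).
Proof.
move=> sqfJ; have sqf := mingens_squarefree sqfJ; apply/setP => W; rewrite !inE.
rewrite asbool_neg; congr (~~ _); rewrite prodX_set -{1}(monomial_span_mingens sqfJ).
apply/asboolP/exists_inP => [/monomial_spanP[u Ju]|[U /mem_generator_sets JU sub]].
  rewrite -(set_of_mnmK (sqf u Ju)) mnm_of_set_le => sub.
  exists (set_of_mnm u) => //.
  by apply/mem_generator_sets; rewrite set_of_mnmK //; exact: sqf.
by apply/monomial_spanP; exists (mnm_of_set U); rewrite ?mnm_of_set_le.
Qed.

Lemma newton_dual_squarefree I :
  squarefree_monomial_ideal I -> squarefree_monomial_ideal (newton_dual I).
Proof.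
move=> /mingens_squarefree sqf; eexists; last by [].
by move=> _ [u /sqf/set_of_mnmK <- <-]; rewrite full_sub_mnm_of_set; exact: squarefree_mnm_of_set.
Qed.

Lemma card_generator_sets I d U :
  generated_in_degree d I -> U \in generator_sets I -> #|U| = d.
Proof. by move=> degI /mem_generator_sets /degI; rewrite mdeg_mnm_of_set. Qed.

Lemma generator_sets_newton_dual I d :
    squarefree_monomial_ideal I -> generated_in_degree d I ->
  generator_sets (newton_dual I) = complements (generator_sets I).
Proof.
move=> sqfI degI; have sqf := mingens_squarefree sqfI.
apply/setP => U; rewrite mem_complements.
have dualE : mingens (newton_dual I) =
    [set (full_monomial n - u)%MM | u in mingens I].
  apply: (@mingens_equidegree _ (n - d)%N) => _ [u Iu <-].
  rewrite -(set_of_mnmK (sqf u Iu)) full_sub_mnm_of_set mdeg_mnm_of_set.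
  rewrite -(degI u Iu) -{2}(set_of_mnmK (sqf u Iu)) mdeg_mnm_of_set.
  by rewrite cardsCs finset.setCK card_ord.
apply/idP/idP => /mem_generator_sets.
  rewrite dualE => -[u Iu]; rewrite -(set_of_mnmK (sqf u Iu)) full_sub_mnm_of_set.
  move/(can_inj (@mnm_of_setK n)) => <-; apply/mem_generator_sets.
  by rewrite finset.setCK set_of_mnmK //; exact: sqf.
move=> IU; apply/mem_generator_sets; rewrite dualE.
by exists (mnm_of_set (~: U)%SET); rewrite // full_sub_mnm_of_set finset.setCK.
Qed.

(** A set with more than d elements contains a (d+1)-set, whose monomial is a
    generator times a variable. *)
Lemma upper_perfect_avoiders I d W : squarefree_monomial_ideal I ->
    upper_perfect d (mingens I) ->
  W \in avoiders (generator_sets I) -> (#|W| <= d)%N.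
Proof.
move=> sqfI up; rewrite inE leqNgt; apply: contra => /exists_subset_card[T TW Td].
have : @sm n (d%:Z + 1) (mnm_of_set T).
  split; first exact: squarefree_mnm_of_set.
  by rewrite mdeg_mnm_of_set Td; lia.
rewrite -up => -[g [i [Ig _ eqT]]].
have sqg := mingens_squarefree sqfI Ig.
apply/exists_inP; exists (set_of_mnm g).
  by apply/mem_generator_sets; rewrite set_of_mnmK.
apply: fintype.subset_trans TW; rewrite -mnm_of_set_le set_of_mnmK // eqT.
exact: lem_addr.
Qed.

(** A set with fewer than d elements extends to a (d-1)-set, whose monomial is a
    generator divided by a variable. *)
Lemma lower_perfect_down_closure I d W : squarefree_monomial_ideal I ->
    lower_perfect d (mingens I) ->
  (#|W| < d <= n)%N -> W \in down_closure (generator_sets I).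
Proof.
move=> sqfI lp ltWd; have [|T WT Td] := @exists_superset_card n W d.-1; first by lia.
have : @sm n (d%:Z - 1) (mnm_of_set T).
  split; first exact: squarefree_mnm_of_set.
  by rewrite mdeg_mnm_of_set Td; lia.
rewrite -lp => -[g [i [Ig _ eqT]]].
have sqg := mingens_squarefree sqfI Ig.
rewrite inE; apply/exists_inP; exists (set_of_mnm g).
  by apply/mem_generator_sets; rewrite set_of_mnmK.
apply: fintype.subset_trans WT _; rewrite -mnm_of_set_le set_of_mnmK // eqT.
by apply/mnm_lepP => j; rewrite mnmBE leq_subr.
Qed.

(** Faces are counted here by their number of elements, which is the dimension
    plus one: complementation then acts on indices by k |-> n - k. *)
Definition fnum_diff J (k : nat) : int :=
  (fnum (k%:Z - 1) (nonface_complex J))%:Z - (fnum (k%:Z - 1) (facet_complex J))%:Z.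

(** The size bound makes the conditions in dimensions above n - 1, where neither
    complex has faces, hold trivially. *)
Lemma quasi_f_idealP J (t : seq int) : (size t <= n.+1)%N ->
  quasi_f_ideal J t <->
  same_dimension (facet_complex J) (nonface_complex J) /\
  forall k, (k <= n)%N -> fnum_diff J k = nth 0 t k.
Proof.
move=> le_tn; split=> -[eqd diff]; split=> //.
  move=> k _; rewrite /fnum_diff diff; last by lia.
  by rewrite /type_entry; congr nth; lia.
move=> i ge_i; have [k ->] : exists k : nat, i = k%:Z - 1.
  by exists (absz (i + 1)); lia.
rewrite -/(fnum_diff J k); have -> : type_entry t (k%:Z - 1) = nth 0 t k.
  by rewrite /type_entry; congr nth; lia.
have [/diff //|lt_nk] := leqP k n.
rewrite /fnum_diff !fnum_gt // nth_default //; exact: leq_trans le_tn lt_nk.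
Qed.

(** Alexander duality exchanges the two complexes and also turns each face number
    into its binomial complement; the two changes of sign cancel. *)
Lemma fnum_diff_newton_dual I d k :
    squarefree_monomial_ideal I -> generated_in_degree d I -> (k <= n)%N ->
  fnum_diff (newton_dual I) k = fnum_diff I (n - k).
Proof.
move=> sqfI degI le_kn; have sqfD := newton_dual_squarefree sqfI.
rewrite /fnum_diff facet_complexE // nonface_complexE //.
rewrite (facet_complexE sqfI) (nonface_complexE sqfI).
rewrite (generator_sets_newton_dual sqfI degI).
rewrite avoiders_complements down_closure_complements.
have := fnum_alexander_dual (down_closure (generator_sets I)) le_kn.
have := fnum_alexander_dual (avoiders (generator_sets I)) le_kn.
by lia.
Qed.

End SquarefreeIdeals.

Theorem theorem4p5 (F : fieldType) (n d : nat) (I : set {mpoly F[n]})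
    (a : d.+1.-tuple int) :
  squarefree_monomial_ideal I ->
  generated_in_degree d I ->
  supp I = [set: 'I_n] ->
  perfect d (mingens I) ->
  quasi_f_ideal I a <-> quasi_f_ideal (newton_dual I) (reversed_type n a).
Proof.
move=> sqfI degI _ [lp up]; have sqfD := newton_dual_squarefree sqfI.
have eqdI := same_dimension_complements
  (fun U => @card_generator_sets F n I d U degI)
  (fun W => @upper_perfect_avoiders F n I d W sqfI up)
  (fun W => @lower_perfect_down_closure F n I d W sqfI lp).
rewrite -(generator_sets_newton_dual sqfI degI) -!facet_complexE // in eqdI.
rewrite -!nonface_complexE // in eqdI.
(* If n < d no squarefree monomial has degree d, so the facet complex is empty and
   neither ideal is a quasi f-ideal. *)
have [lt_nd|le_dn] := ltnP n d.
  suff neqd : ~ same_dimension (facet_complex I) (nonface_complex I).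
    by split=> -[/[dup] /eqdI].
  case=> e [[[W + _] _] _]; rewrite facet_complexE // inE => /exists_inP[U HU _].
  have := max_card U; rewrite (card_generator_sets degI HU) card_ord; lia.
rewrite !quasi_f_idealP ?size_mkseq ?size_tuple // -eqdI.
have diffD k := @fnum_diff_newton_dual F n I d k sqfI degI.
have revE k : (k <= n)%N -> nth 0 (reversed_type n a) k = nth 0 a (n - k).
  by move=> le_kn; rewrite nth_mkseq // /type_entry; congr nth; lia.
split=> -[eqd diff]; split=> // k le_kn.
  by rewrite diffD // revE // diff // leq_subr.
have := diff (n - k)%N; rewrite diffD ?revE ?leq_subr // subKn //; exact.
Qed.
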